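(* Let $(X,\mathcal{B},\mu,T)$ be a non-atomic ergodic measure-preserving dynamical system. Then there is a set $A\in\mathcal{B}$ such that for $\mu$-almost every $x\in X$, $$\limsup_{N\to\infty}\frac1N\sum_{n=1}^N 1_A(T^{\Omega(n)}x)=1\qquad\text{and}\qquad \liminf_{N\to\infty}\frac1N\sum_{n=1}^N 1_A(T^{\Omega(n)}x)=0,$$ where $1_A$ denotes the indicator function of $A$.
   Context: For $n\in\mathbb{N}=\{1,2,\dots\}$, $\Omega(n)$ denotes the number of prime factors of $n$ counted with multiplicity (so $\Omega(1)=0$). A measure-preserving dynamical system $(X,\mathcal{B},\mu,T)$ consists of a compact metric space $X$, its Borel $\sigma$-algebra $\mathcal{B}$, a Borel probability measure $\mu$, and a measurable map $T:X\to X$ with $\mu(T^{-1}A)=\mu(A)$ for all $A\in\mathcal{B}$. It is ergodic if every $A\in\mathcal{B}$ with $T^{-1}A=A$ has $\mu(A)\in\{0,1\}$. It is non-atomic if $\mu$ has no atoms. *)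

(* Defs.v *)
From HB Require Import structures.
From mathcomp Require Import all_boot all_order all_algebra.
From mathcomp Require Import all_classical all_reals all_analysis.
Set Implicit Arguments.
Unset Strict Implicit.
Unset Printing Implicit Defensive.
Import Order.TTheory GRing.Theory Num.Theory.

Local Open Scope classical_set_scope.
Local Open Scope ring_scope.

(* The base point is only there because every [measurableType] is pointed; a
   space that carries a probability measure is nonempty anyway. *)
#[short(type="pmetricType")]
HB.structure Definition PointedMetric (R : numDomainType) :=
  { X of Metric R X & Pointed X }.

(* A notation, so that the [measurableType] structure on [X] generated by the
   open sets is found; the points are those of [X]. *)
Notation borel X := (g_sigma_algebraType (@open X)).

Definition Omega (n : nat) : nat := (\sum_(p <- primes n) logn p n)%N.

Section dynamics.
Context d (X : measurableType d) (R : realType).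
Implicit Types (mu : probability X R) (T : X -> X) (A B : set X).
Local Open Scope ereal_scope.

Definition measure_preserving mu T : Prop :=
  measurable_fun [set: X] T /\
  forall A, measurable A -> mu (T @^-1` A) = mu A.

Definition ergodic mu T : Prop :=
  forall A, measurable A -> T @^-1` A = A -> mu A = 0 \/ mu A = 1.

Definition atom mu A : Prop :=
  [/\ measurable A, 0 < mu A &
      forall B, measurable B -> B `<=` A -> mu B = 0 \/ mu B = mu A].

Definition non_atomic mu : Prop := forall A, ~ atom mu A.

End dynamics.

(* The value at [N = 0] is the junk [0 / 0 = 0]. *)
Definition Omega_average (R : realType) (X : Type) (T : X -> X) (A : set X)
    (x : X) (N : nat) : R :=
  (\sum_(1 <= n < N.+1) \1_A (iter (Omega n) T x)) / N%:R.

(* Main.v *)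
Require Import Defs.
From mathcomp Require Import all_boot all_order all_algebra.
From mathcomp Require Import all_classical all_reals all_analysis.
From mathcomp Require Import zify ring lra.

Set Implicit Arguments.
Unset Strict Implicit.
Unset Printing Implicit Defensive.
Import Order.TTheory GRing.Theory Num.Theory.

Local Open Scope classical_set_scope.
Local Open Scope ring_scope.

(** The orbit is sampled at the times [Omega n], and by Turán's variance argument
[Omega n] is very concentrated: for every [M] and every large [m] there is an [N] such
that all but a proportion [1 / M] of the [n <= N] satisfy [|Omega n - m| <= m / M]
([Omega_concentration]). Hence, if the orbit of [x] stays in [A] during all the times
of a window around [m] of width a small fixed proportion of [m], the average over
[n <= N] is nearly [1], and it is nearly [0] if the orbit stays outside [A]
([run_average]). It suffices to find [A] such that almost every orbit has
infinitely many such windows of both kinds, with [M] tending to infinity.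

A single scale is provided by a Rokhlin-type tower ([exists_long_runs]). Take a set [E]
of tiny positive measure, which exists as [mu] is non-atomic and which almost every
orbit visits by ergodicity. Cut the time remaining before the first visit to [E] into
blocks of length [L], numbered modulo [M.+1], and let [F] be the set of points in a
block numbered [M]. The [M.+1] classes are disjoint and [F] has the smallest measure,
so [mu F <= 1 / M.+1]; on the other hand an orbit that does not visit [E] too early
crosses a whole block numbered [M], that is stays in [F] during [L] consecutive steps,
before time about [(M + 2) * L], which is comparable to [L].

These scales are then superposed. The sets [F k] are constructed one after the other,
[F k] being so small that with probability at least [1 - 2 ^ - k] an orbit does not
meet [F k] during the whole time horizon [H k] of the previous scales. Let [A] be the
set of points [y] for which the last [k] with [y] in [F k] is even. By Borel-Cantelli,
for almost every [x] and all large [k], the orbit of [x] has a window at scale [k] that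
the later scales leave alone, and it is in [A] if [k] is even and outside [A] if [k] is
odd ([Omega_average_oscillates]). *)

(** * Divergence of the sum of the reciprocals of the primes *)

Lemma logn_le_pow2 (k n p : nat) : (0 < n <= 2 ^ k)%N -> (logn p n <= k)%N.
Proof.
move=> /andP[n0 nk]; case: (boolP (prime p)) => [pp|/negbTE pp]; last first.
  by rewrite lognE pp.
rewrite -(leq_exp2l _ _ (isT : 1 < 2)%N).
apply: leq_trans nk; apply: leq_trans (dvdn_leq n0 (pfactor_dvdnn p n)).
by case: (logn p n) => // e; rewrite leq_exp2r// prime_gt1.
Qed.

(** A number up to [2 ^ k] is determined by its exponents, which are at most [k], at the
primes below [B]: smooth numbers are rare. *)
Lemma card_smooth (B k : nat) :
  (\sum_(1 <= n < (2 ^ k).+1) all (fun p => p < B) (primes n) <= k.+1 ^ B)%N.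
Proof.
rewrite big_add1 /= big_mkord.
pose smooth (i : 'I_(2 ^ k)) := all (fun p => p < B)%N (primes i.+1).
rewrite (_ : (\sum_i _)%N = #|[pred i | smooth i]|)%N; last first.
  rewrite -sum1_card [RHS]big_mkcond; apply: eq_bigr => i _.
  by rewrite inE /smooth; case: all.
pose exps (i : 'I_(2 ^ k)) : {ffun 'I_B -> 'I_k.+1} :=
  [ffun p : 'I_B => inord (logn p i.+1)].
rewrite -[leqRHS](_ : #|{: {ffun 'I_B -> 'I_k.+1}}| = _)%N; last first.
  by rewrite card_ffun !card_ord.
rewrite -(@card_in_imset _ _ exps [pred i | smooth i]); first exact: max_card.
move=> i j; rewrite !inE => si sj eij.
apply: val_inj; apply: succn_inj; apply: eqn_from_log => // p.
have smoothE (l : 'I_(2 ^ k)) : smooth l -> (B <= p)%N -> logn p l.+1 = 0%N.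
  move=> sl Bp; apply/eqP; rewrite -leqn0 leqNgt logn_gt0.
  by apply/negP => /(allP sl); rewrite ltnNge Bp.
have [pB|Bp] := ltnP p B; last by rewrite !smoothE.
have /ffunP/(_ (Ordinal pB)) := eij; rewrite !ffunE => /(congr1 (@nat_of_ord _)).
by rewrite !inordK// ltnS logn_le_pow2//= ltn_ord.
Qed.

(** This makes the bound of [card_smooth] less than half of [2 ^ k]. *)
Lemma poly_lt_exp (B : nat) : exists k, (2 * k.+1 ^ B < 2 ^ k)%N.
Proof.
(* For [k = 2 ^ t] the claim follows from [t.+1 * B + 1 < 2 ^ t], as
   [k.+1 <= 2 ^ t.+1]. *)
pose t := (2 * B + 3)%N; exists (2 ^ t)%N.
have tB : (t.+1 * B + 1 < 2 ^ t)%N.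
  have BltE := ltn_expl B (isT : 1 < 2)%N.
  have -> : (2 ^ t = 2 ^ B * 2 ^ B * 8)%N.
    by rewrite /t mul2n -addnn !expnD.
  rewrite /t; nia.
apply: (@leq_ltn_trans (2 ^ (t.+1 * B + 1))); last by rewrite ltn_exp2l.
rewrite addn1 expnS leq_mul2l /= expnM.
have : (2 ^ t < 2 ^ t.+1)%N by rewrite ltn_exp2l.
by case: B t tB => [|B] t tB h; rewrite ?expn0// leq_exp2r.
Qed.

Definition prime_recip_sum (N : nat) : rat :=
  \sum_(1 <= p < N.+1 | prime p) p%:R^-1.

Lemma natr_divn_le (N d : nat) : (N %/ d)%:R <= N%:R / d%:R :> rat.
Proof.
have [->|d0] := posnP d; first by rewrite divn0 invr0 mulr0.
by rewrite ler_pdivlMr ?ltr0n// -natrM ler_nat leq_trunc_div.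
Qed.

Lemma natr_divn_ge (N d : nat) : (0 < d)%N -> N%:R / d%:R - 1 <= (N %/ d)%:R :> rat.
Proof.
move=> d0; rewrite lerBlDr ler_pdivrMr ?ltr0n// natr1 -natrM ler_nat.
by rewrite ltnW// ltn_ceil.
Qed.

(** Erdős's argument for the divergence of the sum of the reciprocals of the primes: for
a suitable [N], at least half of the [n <= N] are not [B]-smooth, while at most [N / p]
of them are divisible by a given prime [p]. *)
Lemma prime_recip_tail (B : nat) :
  exists N, (B <= N)%N /\ 2^-1 <= \sum_(B <= p < N.+1 | prime p) p%:R^-1 :> rat.
Proof.
have [k kB] := poly_lt_exp B.
have k0 : (0 < k)%N by case: k kB => //; rewrite exp1n.
have smooth_lt : (2 * \sum_(1 <= n < (2 ^ k).+1)
    all (fun p => p < B) (primes n) < 2 ^ k)%N.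
  by apply: leq_ltn_trans kB; rewrite leq_mul2l card_smooth.
set N := (2 ^ k)%N in smooth_lt *.
exists N; split.
  apply: leq_trans (ltnW kB); case: (B) => // b.
  apply: (@leq_trans (k.+1 ^ b.+1)); last by rewrite leq_pmull.
  by apply: ltnW; apply: leq_trans (ltn_expl b.+1 (isT : 1 < 2)%N) _; rewrite leq_exp2r.
have cover n : (1 <= n < N.+1)%N ->
    (1 <= all (fun p => p < B) (primes n) +
       \sum_(B <= p < N.+1 | prime p) (p %| n))%N.
  move=> /andP[n0 nN]; case: allP => //= H; rewrite add0n.
  have /allPn[p pn] : ~~ all (fun p => p < B)%N (primes n) by apply/allP.
  rewrite -leqNgt => Bp.
  move: pn; rewrite mem_primes => /and3P[pp _ pn].
  rewrite (big_rem p) /=; last first.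
    by rewrite mem_index_iota Bp ltnS (leq_trans (dvdn_leq n0 pn)).
  by rewrite pp pn.
have : (N <= \sum_(1 <= n < N.+1) all (fun p => p < B) (primes n) +
    \sum_(B <= p < N.+1 | prime p) N %/ p)%N.
  under [X in (_ <= _ + X)%N]eq_bigr do rewrite divn_count_dvd.
  rewrite exchange_big /= -big_split /=.
  rewrite -[leqLHS](_ : \sum_(1 <= n < N.+1) 1 = N)%N; last first.
    by rewrite sum_nat_const_nat muln1 subSS subn0.
  rewrite big_nat [leqRHS]big_nat; apply: leq_sum => n; exact: cover.
rewrite -(ler_nat rat) natrD [X in _ <= _ + X]natr_sum => le1.
have le2 : \sum_(B <= p < N.+1 | prime p) (N %/ p)%:R <=
    N%:R * \sum_(B <= p < N.+1 | prime p) p%:R^-1 :> rat.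
  by rewrite mulr_sumr; apply: ler_sum => p _; exact: natr_divn_le.
have N0 : 0 < N%:R :> rat by rewrite ltr0n expn_gt0.
move: smooth_lt; rewrite -(ltr_nat rat) natrM => le3.
rewrite -(ler_pM2l N0); lra.
Qed.

Lemma prime_recip_sumD (M N : nat) : (M <= N)%N ->
  prime_recip_sum N =
  prime_recip_sum M + \sum_(M.+1 <= p < N.+1 | prime p) p%:R^-1.
Proof. by move=> MN; rewrite /prime_recip_sum -big_cat_nat. Qed.

Lemma prime_recip_sum_unbounded (m : nat) : exists N, m%:R <= prime_recip_sum N.
Proof.
suff H i : exists N, i%:R / 2 <= prime_recip_sum N.
  by have [N] := H (2 * m)%N; rewrite natrM => ?; exists N; lra.
elim: i => [|i [N IH]].
  by exists 0%N; rewrite mul0r sumr_ge0// => p _; rewrite invr_ge0.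
have [N' [NN' le]] := prime_recip_tail N.+1.
exists N'; rewrite (prime_recip_sumD (ltnW NN')) -natr1; lra.
Qed.

(** The steps of the sum are at most [1], so that its first value above [m] is at most
[m + 1]; this [N] is the one for which [Omega] concentrates around [m]. *)
Lemma prime_recip_sum_between (m : nat) :
  exists N, [/\ (m <= N)%N, m%:R <= prime_recip_sum N &
    prime_recip_sum N <= m%:R + 1].
Proof.
have [N mN Nmin] := ex_minnP (prime_recip_sum_unbounded m).
have leS n : prime_recip_sum n.+1 <= prime_recip_sum n + 1.
  rewrite (prime_recip_sumD (leqnSn n)) lerD2l big_mkcond big_nat1.
  by case: ifP => // _; rewrite invf_le1 ?ltr0n// ler1n.
exists N; split => //.
  suff : prime_recip_sum N <= N%:R by move=> /(le_trans mN); rewrite ler_nat.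
  elim: {mN Nmin} N => [|n IH]; first by rewrite /prime_recip_sum big_nil.
  by rewrite (le_trans (leS n))// -natr1 lerD2r.
case: N {mN} Nmin => [|N] Nmin.
  by rewrite /prime_recip_sum big_nil addr_ge0.
apply: le_trans (leS N) _; rewrite lerD2r leNgt; apply/negP => /ltW /Nmin.
by rewrite ltnn.
Qed.

(** * Concentration of Omega *)

Definition omega (n : nat) : nat := size (primes n).

Lemma sum_primes (N n : nat) (F : nat -> nat) : (0 < n <= N)%N ->
  (\sum_(p <- primes n) F p = \sum_(1 <= p < N.+1 | prime p) (p %| n) * F p)%N.
Proof.
move=> /andP[n0 nN].
have -> : (\sum_(1 <= p < N.+1 | prime p) (p %| n) * F p =
    \sum_(1 <= p < N.+1 | prime p && (p %| n)) F p)%N.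
  by rewrite big_mkcondr; apply: eq_bigr => p _; case: (p %| n)%N; rewrite ?mul1n.
rewrite -[RHS]big_filter; apply: perm_big; apply: uniq_perm.
- exact: primes_uniq.
- by rewrite filter_uniq// iota_uniq.
move=> p; rewrite mem_primes mem_filter mem_index_iota n0 /= -andbA.
case: (boolP (prime p)) => //= pp; rewrite prime_gt0// ltnS /=.
by case: (boolP (p %| n)%N) => //= /(dvdn_leq n0) /leq_trans ->.
Qed.

Lemma omegaE (N n : nat) : (0 < n <= N)%N ->
  omega n = (\sum_(1 <= p < N.+1 | prime p) (p %| n))%N.
Proof.
move=> nN; rewrite /omega -sum1_size (sum_primes _ nN).
by apply: eq_bigr => p _; rewrite muln1.
Qed.

Lemma OmegaE (N n : nat) : (0 < n <= N)%N ->
  Omega n = (\sum_(1 <= p < N.+1 | prime p) logn p n)%N.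
Proof.
move=> nN; rewrite /Omega (sum_primes _ nN); apply: eq_bigr => p pp.
by case: (boolP (p %| n)%N); rewrite ?mul1n// lognE => /negbTE ->; rewrite !andbF.
Qed.

Lemma omega_le_Omega (n : nat) : (omega n <= Omega n)%N.
Proof.
rewrite /omega /Omega -sum1_size big_seq [leqRHS]big_seq.
by apply: leq_sum => p; rewrite logn_gt0.
Qed.

Lemma sum_omega (N : nat) :
  (\sum_(1 <= n < N.+1) omega n = \sum_(1 <= p < N.+1 | prime p) N %/ p)%N.
Proof.
rewrite big_nat; under eq_bigr => n nN do rewrite (omegaE nN).
rewrite -big_nat exchange_big /=.
by apply: eq_bigr => p _; rewrite divn_count_dvd.
Qed.

Lemma sum_omega_ge (N : nat) :
  N%:R * (prime_recip_sum N - 1) <= (\sum_(1 <= n < N.+1) omega n)%:R :> rat.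
Proof.
rewrite sum_omega natr_sum /prime_recip_sum mulrBr mulr1 mulr_sumr.
have le1 : \sum_(1 <= p < N.+1 | prime p) 1 <= N%:R :> rat.
  rewrite big_mkcond /= (_ : N%:R = \sum_(1 <= p < N.+1) 1); last first.
    by rewrite sumr_const_nat subSS subn0.
  by apply: ler_sum => p _; case: ifP.
rewrite lerBlDr; apply: (le_trans _ (lerD (lexx _) le1)).
rewrite -big_split /=; apply: ler_sum => p pp.
by rewrite -lerBlDr natr_divn_ge// prime_gt0.
Qed.

(** Divisibilities by two distinct primes are independent up to rounding; the diagonal
terms are counted apart. *)
Lemma sum_dvd_prime2 (N p q : nat) : prime p -> prime q ->
  (\sum_(1 <= n < N.+1) (p %| n) * (q %| n))%:R <=
  N%:R / (p%:R * q%:R) + (p == q)%:R * (N%:R / p%:R) :> rat.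
Proof.
move=> pp qp; have [->|pq] := eqVneq p q.
  rewrite mul1r -[leLHS]add0r lerD//.
  under eq_bigr do rewrite mulnb andbb.
  by rewrite -divn_count_dvd natr_divn_le.
rewrite mul0r addr0.
have cpq : coprime p q by rewrite prime_coprime// dvdn_prime2.
under eq_bigr do rewrite mulnb -Gauss_dvd//.
by rewrite -divn_count_dvd -natrM natr_divn_le.
Qed.

(** Together with [sum_omega_ge], this bounds the variance of [omega] by a multiple of
its mean [prime_recip_sum N]. *)
Lemma sum_omega_sqr_le (N : nat) :
  (\sum_(1 <= n < N.+1) omega n ^ 2)%:R <=
  N%:R * (prime_recip_sum N ^+ 2 + prime_recip_sum N) :> rat.
Proof.
have -> : (\sum_(1 <= n < N.+1) omega n ^ 2 =
    \sum_(1 <= p < N.+1 | prime p) \sum_(1 <= q < N.+1 | prime q)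
      \sum_(1 <= n < N.+1) (p %| n) * (q %| n))%N.
  under [RHS]eq_bigr do rewrite exchange_big /=.
  rewrite [RHS]exchange_big /= big_nat [RHS]big_nat; apply: eq_bigr => n nN.
  rewrite (omegaE nN) -mulnn big_distrl /=; apply: eq_bigr => p _.
  by rewrite big_distrr.
rewrite natr_sum.
have -> : N%:R * (prime_recip_sum N ^+ 2 + prime_recip_sum N) =
    \sum_(1 <= p < N.+1 | prime p)
      (N%:R * p%:R^-1 * prime_recip_sum N + N%:R / p%:R).
  by rewrite big_split /= -mulr_suml -mulr_sumr -/(prime_recip_sum N); ring.
rewrite big_nat_cond [leRHS]big_nat_cond; apply: ler_sum => p /andP[pN pp].
rewrite natr_sum.
apply: (@le_trans _ _ (\sum_(1 <= q < N.+1 | prime q)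
    (N%:R / (p%:R * q%:R) + (p == q)%:R * (N%:R / p%:R)))).
  by apply: ler_sum => q qp; exact: sum_dvd_prime2.
rewrite big_split /= lerD//.
  by rewrite mulr_sumr ler_sum// => q _; rewrite invfM mulrA.
rewrite -mulr_suml ler_piMl ?divr_ge0// big_mkcond /=.
rewrite (bigD1_seq p) ?iota_uniq ?mem_index_iota//= pp eqxx.
by rewrite big1 ?addr0// => q /negbTE; rewrite eq_sym => ->; case: ifP.
Qed.

Lemma sum_logn_fact (N p : nat) : prime p ->
  (\sum_(1 <= n < N.+1) logn p n = logn p N`!)%N.
Proof.
move=> pp; elim: N => [|N IH]; first by rewrite big_nil logn1.
by rewrite big_nat_recr//= IH factS lognM ?fact_gt0// addnC.
Qed.

Lemma sum_geom_tail (x : rat) (K : nat) : 2 <= x ->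
  \sum_(2 <= k < K) x^-1 ^+ k <= (x - 1)^-1 - x^-1.
Proof.
move=> x2; have x0 : 0 < x by lra.
have x1 : x - 1 != 0 by lra.
have x0' : x != 0 by lra.
have [K2|K2] := leqP K 2.
  by rewrite big_geq// subr_ge0 lef_pV2 ?posrE; lra.
rewrite -(subnK (ltnW K2)) addn2; move: (K - 2)%N => {K2} i.
suff -> : \sum_(2 <= k < i.+2) x^-1 ^+ k =
    (x - 1)^-1 - x^-1 - x^-1 ^+ i.+1 / (x - 1).
  rewrite gerBl divr_ge0 ?exprn_ge0 ?invr_ge0; lra.
elim: i => [|i IH]; first by rewrite big_geq// expr1; field; rewrite x0' x1.
by rewrite big_nat_recr//= IH !exprS; field; rewrite x0' x1.
Qed.

(** Passing from [omega] to [Omega] costs [O(1)] on average: the difference counts the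
prime powers [p ^ k] dividing [n] with [k >= 2], and the sum over [p] of the geometric
tails [1 / (p * (p - 1))] telescopes to at most [1]. *)
Lemma sum_Omega_le (N : nat) :
  (\sum_(1 <= n < N.+1) Omega n)%:R <=
  (\sum_(1 <= n < N.+1) omega n)%:R + N%:R :> rat.
Proof.
rewrite sum_omega.
have -> : (\sum_(1 <= n < N.+1) Omega n =
    \sum_(1 <= p < N.+1 | prime p) \sum_(1 <= k < N.+1) N %/ p ^ k)%N.
  rewrite big_nat; under eq_bigr => n nN do rewrite (OmegaE nN).
  rewrite -big_nat exchange_big /=.
  by apply: eq_bigr => p pp; rewrite sum_logn_fact// logn_fact.
case: N => [|N]; first by rewrite !big_nil.
rewrite !natr_sum.
apply: (@le_trans _ _ (\sum_(1 <= p < N.+2 | prime p)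
    ((N.+1 %/ p)%:R + N.+1%:R * ((p%:R - 1)^-1 - p%:R^-1)))).
  apply: ler_sum => p pp; rewrite big_ltn//= expn1 natrD lerD2l natr_sum.
  apply: le_trans (ler_wpM2l (ler0n _ _) (@sum_geom_tail p%:R N.+2 _)); last first.
    by rewrite ler_nat prime_gt1.
  rewrite mulr_sumr; apply: ler_sum => k _.
  by rewrite exprVn -natrX natr_divn_le.
rewrite big_split /= lerD2l -mulr_sumr ler_piMr//.
rewrite big_mkcond big_ltn//= add0r.
apply: (@le_trans _ _ (\sum_(2 <= p < N.+2) (- p%:R^-1 - - (p.-1)%:R^-1))).
  rewrite big_nat [leRHS]big_nat; apply: ler_sum => p /andP[p2 _].
  have pE : p.-1%:R = p%:R - 1 :> rat by rewrite -subn1 natrB// ltnW.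
  have p2' : 2 <= p%:R :> rat by rewrite ler_nat.
  rewrite pE opprK [leRHS]addrC; case: ifP => // _.
  by rewrite subr_ge0 lef_pV2 ?posrE; lra.
case: N => [|N]; first by rewrite big_geq.
rewrite big_add1 /= telescope_sumr// opprK invr1 addrC gerDl oppr_le0.
by rewrite invr_ge0.
Qed.

(** The Turán-Chebyshev inequality. A bad [n] has [omega n] at distance at least
[m / (2 * M)] of [m], or [Omega n - omega n >= m / (2 * M)]; the second moment
controls the first case and the mean controls the second. *)
Lemma Omega_concentration (M : nat) : (0 < M)%N -> exists m0, forall m, (m0 <= m)%N ->
  exists N, [/\ (0 < N)%N, (m <= N)%N &
    (M * \sum_(1 <= n < N.+1) ~~ (M.-1 * m <= M * Omega n <= M.+1 * m) <= N)%N].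
Proof.
(* The final estimate requires [m >= 20 * M ^ 3 + 2 * M ^ 2]. *)
move=> M0; exists (22 * M ^ 3 + 1)%N => m mM.
have [N [mN mS Sm]] := prime_recip_sum_between m.
have N0 : (0 < N)%N by apply: leq_trans mN; lia.
exists N; split => //.
pose bad n := ~~ (M.-1 * m <= M * Omega n <= M.+1 * m)%N.
under eq_bigr do rewrite -/(bad _).
set S := prime_recip_sum N in mS Sm.
have sO := sum_Omega_le N; have sw := sum_omega_ge N.
have sw2 := sum_omega_sqr_le N; rewrite -/S in sw sw2.
set x := m%:R : rat in mS Sm *; set y := M%:R : rat.
have M0' : 1 <= y by rewrite ler1n.
have xM : 22 * y ^+ 3 + 1 <= x by rewrite -natrX -natrM natr1 ler_nat -addn1.
have x0 : 1 <= x by apply: le_trans xM; rewrite lerDr mulr_ge0// exprn_ge0; lra.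
have Nx : 0 < N%:R :> rat by rewrite ltr0n.
have badE n : bad n -> x < y * `|(Omega n)%:R - x|.
  rewrite /bad negb_and -!ltnNge -!(ltr_nat rat) !natrM -(natr1 M).
  have -> : M.-1%:R = y - 1 by rewrite -subn1 natrB.
  rewrite -/x -/y => /orP[|] h.
    have : x < y * (x - (Omega n)%:R) by lra.
    move=> /lt_le_trans; apply; rewrite ler_pM2l; last lra.
    by rewrite distrC ler_norm.
  have : x < y * ((Omega n)%:R - x) by lra.
  by move=> /lt_le_trans; apply; rewrite ler_pM2l ?ler_norm//; lra.
(* The pointwise Chebyshev bound, multiplied by [m ^ 2]. *)
have bad_le n : x ^+ 2 * (bad n)%:R <=
    4 * y ^+ 2 * ((omega n ^ 2)%:R - 2 * x * (omega n)%:R + x ^+ 2) +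
    2 * y * x * ((Omega n)%:R - (omega n)%:R).
  have oO : (omega n)%:R <= (Omega n)%:R :> rat by rewrite ler_nat omega_le_Omega.
  rewrite natrX; set a := (omega n)%:R in oO *; set b := (Omega n)%:R in oO *.
  have -> : a ^+ 2 - 2 * x * a + x ^+ 2 = (a - x) ^+ 2 by ring.
  have nn1 : 0 <= 4 * y ^+ 2 * (a - x) ^+ 2.
    by rewrite mulr_ge0 ?sqr_ge0// mulr_ge0 ?sqr_ge0.
  have nn2 : 0 <= 2 * y * x * (b - a).
    by rewrite !mulr_ge0 ?subr_ge0//; lra.
  case: (boolP (bad n)) => [/badE h|_]; last by rewrite mulr0 addr_ge0.
  rewrite mulr1.
  have tri : `|b - x| <= `|a - x| + (b - a).
    have := ler_normD (a - x) (b - a).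
    by rewrite (_ : a - x + (b - a) = b - x) ?[`|b - a|]ger0_norm ?subr_ge0//; ring.
  have [h1|h1] := leP x (2 * y * (b - a)).
    rewrite -[leLHS]add0r lerD// expr2 mulrAC ler_wpM2r//; lra.
  have h2 : x <= 2 * (y * `|a - x|).
    have : y * `|b - x| <= y * (`|a - x| + (b - a)) by rewrite ler_wpM2l//; lra.
    lra.
  have : x ^+ 2 <= (2 * (y * `|a - x|)) ^+ 2.
    by rewrite ler_sqr ?nnegrE//; lra.
  by rewrite !exprMn -normrX ger0_norm ?sqr_ge0//; lra.
have sum_le : x ^+ 2 * (\sum_(1 <= n < N.+1) bad n)%:R <=
    4 * y ^+ 2 * ((\sum_(1 <= n < N.+1) omega n ^ 2)%:R -
      2 * x * (\sum_(1 <= n < N.+1) omega n)%:R + N%:R * x ^+ 2) +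
    2 * y * x * ((\sum_(1 <= n < N.+1) Omega n)%:R -
      (\sum_(1 <= n < N.+1) omega n)%:R).
  have -> : N%:R * x ^+ 2 = \sum_(1 <= n < N.+1) x ^+ 2.
    by rewrite big_const_nat subSS subn0 iter_addr addr0 mulr_natl.
  rewrite !natr_sum !mulr_sumr -!sumrB -!big_split /= !mulr_sumr -big_split /=.
  by apply: ler_sum.
rewrite -(ler_nat rat) natrM -/y.
have Sm2 : (S - x) ^+ 2 <= 1.
  have := mulr_ge0 (_ : 0 <= S - x) (_ : 0 <= 1 - (S - x)).
  by move=> /(_ ltac:(lra) ltac:(lra)); lra.
(* [prime_recip_sum N] is within [1] of [m]. *)
have var : (\sum_(1 <= n < N.+1) omega n ^ 2)%:R -
      2 * x * (\sum_(1 <= n < N.+1) omega n)%:R + N%:R * x ^+ 2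
    <= N%:R * (5 * x).
  have le1 := ler_wpM2l (_ : 0 <= 2 * x) sw.
  have {}le1 := le1 ltac:(lra).
  have : N%:R * ((S - x) ^+ 2 + S + 2 * x) <= N%:R * (5 * x).
    by rewrite ler_wpM2l//; lra.
  lra.
have h1 := ler_wpM2l (_ : 0 <= 4 * y ^+ 2) var.
have {}h1 := h1 ltac:(rewrite mulr_ge0// sqr_ge0//).
have h2 := ler_wpM2l (_ : 0 <= 2 * y * x) sO.
have {}h2 := h2 ltac:(rewrite !mulr_ge0//; lra).
set b := (\sum_(1 <= n < N.+1) bad n)%:R in sum_le *.
have b0 : 0 <= b by [].
have {sum_le} : x ^+ 2 * b <= x * (N%:R * (20 * y ^+ 2 + 2 * y)) by lra.
rewrite expr2 -mulrA ler_pM2l; last lra.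
move=> h3; rewrite -(ler_pM2l (_ : 0 < x)); last lra.
have : y * (x * b) <= y * (N%:R * (20 * y ^+ 2 + 2 * y)) by rewrite ler_wpM2l//; lra.
have : N%:R * (y * (20 * y ^+ 2 + 2 * y)) <= N%:R * x.
  rewrite ler_wpM2l//; apply: le_trans xM; nra.
lra.
Qed.

(** * Long runs in small sets *)

Section dynamics.
Context d (X : measurableType d) (R : realType) (mu : probability X R)
  (T : X -> X).
Local Open Scope ereal_scope.

Hypothesis mpT : measure_preserving mu T.

Lemma measurable_preimage_iter n A : measurable A -> measurable (iter n T @^-1` A).
Proof.
have [mT _] := mpT => mA; elim: n => [|n IH] //=.
rewrite (_ : _ @^-1` A = T @^-1` (iter n T @^-1` A)); last first.
  by apply/seteqP; split => x /=; rewrite -iterS iterSr.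
by rewrite -[X in measurable X]setTI; exact: mT.
Qed.

Lemma measure_preimage_iter n A : measurable A -> mu (iter n T @^-1` A) = mu A.
Proof.
have [_ pT] := mpT => mA; elim: n => [|n IH] //=.
rewrite (_ : _ @^-1` A = T @^-1` (iter n T @^-1` A)); last first.
  by apply/seteqP; split => x /=; rewrite -iterS iterSr.
by rewrite pT//; exact: measurable_preimage_iter.
Qed.

Lemma measure_hit_le n A : measurable A ->
  mu (\bigcup_(i in `I_n) iter i T @^-1` A) <= n%:R%:E * mu A.
Proof.
move=> mA; rewrite bigcup_mkord.
have := @le_mu_bigsetU _ _ _ mu (fun i => iter i T @^-1` A) n
  (fun i _ => measurable_preimage_iter i mA).
move=> /le_trans; apply.
rewrite (eq_bigr (fun=> mu A)) => [|i _]; last exact: measure_preimage_iter.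
by rewrite sumr_const card_ord mule_natl.
Qed.

(** Visiting [E] infinitely often is an exactly [T]-invariant event, unlike visiting [E]
at all; it is not null since each tail event has measure at least [mu E]. *)
Lemma recurrence E : ergodic mu T -> measurable E -> 0 < mu E ->
  mu (lim_sup_set (fun n => iter n T @^-1` E)) = 1.
Proof.
move=> erg mE E0; set G := fun n => iter n T @^-1` E.
have mG n : measurable (G n) by exact: measurable_preimage_iter.
have mU n : measurable (\bigcup_(k in [set k | (n <= k)%N]) G k).
  by apply: bigcup_measurable.
have inv : T @^-1` lim_sup_set G = lim_sup_set G.
  apply/seteqP; split => x H n _.
    have [k /= nk Gk] := H n I; exists k.+1 => /=; first exact: leqW.
    by move: Gk; rewrite /G /= -iterS iterSr.
  have [[|k] /= nk Gk] := H n.+1 I; first by [].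
  by exists k => //; move: Gk; rewrite /G /= -iterS iterSr.
have mL : measurable (lim_sup_set G) by exact: bigcap_measurable.
have [L0|//] := erg _ mL inv.
have : mu E <= mu (lim_sup_set G).
  have cvgL : mu (\bigcup_(k >= n) G k) @[n --> \oo] --> mu (lim_sup_set G).
    apply: lim_sup_set_cvg => //.
    by rewrite (le_lt_trans (probability_le1 _ (mU 0%N)))// ltry.
  rewrite -(cvg_lim _ cvgL)//; apply: lime_ge.
    by apply/cvg_ex; eexists; exact: cvgL.
  apply: nearW => n; rewrite -(measure_preimage_iter n mE).
  apply: le_measure; rewrite ?inE//; first exact: (mG n).
  by move=> x Gx; exists n => /=.
by rewrite L0 leNgt E0.
Qed.

(** If [B] is not an atom, it splits into two parts of positive measure; [C] is the
smaller one. *)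
Lemma non_atomic_half B : non_atomic mu -> measurable B -> 0 < mu B ->
  exists C, [/\ measurable C, 0 < mu C & mu C + mu C <= mu B].
Proof.
move=> na mB B0; apply: contrapT => noC; apply: (na B); split => // C mC CB.
have mBC : measurable (B `\` C) by exact: measurableD.
have muB : mu B = mu (B `\` C) + mu C.
  by rewrite (measureDI mu mB mC) (setIidr CB).
have [->|] := eqVneq (mu C) 0; first by left.
rewrite -measure_gt0 => C0.
have [D0|] := eqVneq (mu (B `\` C)) 0; first by right; rewrite muB D0 add0e.
rewrite -measure_gt0 => D0.
exfalso; apply: noC; have [CD|DC] := leP (mu C) (mu (B `\` C)).
  by exists C; split => //; rewrite muB leeD2r.
by exists (B `\` C); split => //; rewrite [leRHS]muB leeD2l// ltW.
Qed.

Lemma non_atomic_small (K : nat) : non_atomic mu ->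
  exists E, [/\ measurable E, 0 < mu E & K%:R%:E * mu E <= 1].
Proof.
move=> na; suff H n : exists E,
    [/\ measurable E, 0 < mu E & (2 ^ n)%:R%:E * mu E <= 1].
  have [E [mE E0 E1]] := H K; exists E; split => //.
  apply: le_trans E1; rewrite lee_wpmul2r// lee_fin ler_nat ltnW//.
  exact: ltn_expl.
elim: n => [|n [E [mE E0 E1]]].
  exists setT; split => //; first by rewrite probability_setT.
  by rewrite probability_setT expn0 mul1e.
have [C [mC C0 CE]] := non_atomic_half na mE E0.
exists C; split => //; apply: le_trans E1.
rewrite expnS mulnC natrM EFinM -muleA; apply: lee_wpmul2l => //.
by rewrite mule_natl mule2n.
Qed.

Definition first_hit (E : set X) (n : nat) : set X :=
  (iter n T @^-1` E) `&` \bigcap_(i in `I_n) ~` (iter i T @^-1` E).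

Lemma measurable_first_hit E n : measurable E -> measurable (first_hit E n).
Proof.
move=> mE; apply: measurableI; first exact: measurable_preimage_iter.
apply: bigcap_measurableType => i _; apply: measurableC.
exact: measurable_preimage_iter.
Qed.

Lemma first_hit_inj E m n x : first_hit E m x -> first_hit E n x -> m = n.
Proof.
move=> [Em nEm] [En nEn]; have [mn|nm|//] := ltngtP m n.
  by have := nEn _ mn.
by have := nEm _ nm.
Qed.

Lemma first_hit_iter E n s x :
  first_hit E (n + s) x -> first_hit E n (iter s T x).
Proof.
move=> [/= En nE]; split => /=; first by rewrite -iterD.
by move=> i /= lin; rewrite -iterD; apply: (nE (i + s)%N); rewrite /= ltn_add2r.
Qed.

Lemma first_hit_exists E n x : E (iter n T x) ->
  exists2 m, (m <= n)%N & first_hit E m x.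
Proof.
move=> En; pose P m := `[< E (iter m T x) >].
have [m /asboolP Em mmin] := ex_minnP (ex_intro P n (asboolT En)).
exists m; first by apply: mmin; apply/asboolP.
split => // i /= im Ei; have := mmin i (asboolT Ei); by rewrite leqNgt im.
Qed.

(** Indexing by the time until the first visit to [E], rather than by the time since the
last one, makes sense for a map that is not invertible. *)
Definition hit_block (E : set X) (M L i : nat) : set X :=
  \bigcup_(n in [set n | (n %/ L) %% M = i]%N) first_hit E n.

Lemma measurable_hit_block E M L i : measurable E -> measurable (hit_block E M L i).
Proof. by move=> mE; apply: bigcup_measurable => n _; exact: measurable_first_hit. Qed.

(** Along the orbit the time to [E] decreases, so that [L] steps lead from the class
[i.+1] into the class [i]; the converse inclusion fails as the orbit can also enter the
class [i] just after a visit to [E]. *)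
Lemma measure_hit_block_nonincreasing E M L i : measurable E -> (0 < L)%N ->
  (i.+1 < M)%N -> mu (hit_block E M L i.+1) <= mu (hit_block E M L i).
Proof.
move=> mE L0 iM.
have mb j : measurable (hit_block E M L j) by exact: measurable_hit_block.
rewrite -[leRHS](measure_preimage_iter L)//; apply: le_measure; rewrite ?inE//.
  exact: measurable_preimage_iter.
move=> x [n /= nE hx]; have Ln : (L <= n)%N.
  by rewrite leqNgt; apply/negP => /divn_small n0; rewrite n0 mod0n in nE.
exists (n - L)%N; last by apply: first_hit_iter; rewrite subnK.
move: nE; rewrite -{1}(subnK Ln) divnDr// divnn L0 addn1 /=.
have M0 : (0 < M)%N by lia.
set q := (_ %/ L)%N; move: q => q.
rewrite modnS; case: ifP => // _ [->] //.
Qed.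

(** The [M.+1] classes are disjoint and the last one has the smallest measure. *)
Lemma measure_top_block E M L : measurable E -> (0 < L)%N ->
  M.+1%:R%:E * mu (hit_block E M.+1 L M) <= 1.
Proof.
move=> mE L0; set b := hit_block E M.+1 L.
have mb j : measurable (b j) by exact: measurable_hit_block.
have le_top i : (i <= M)%N -> mu (b M) <= mu (b (M - i)%N).
  elim: i => [|i IH] iM; first by rewrite subn0.
  apply: le_trans (IH (ltnW iM)) _.
  rewrite (_ : M - i = (M - i.+1).+1)%N; last by lia.
  by apply: measure_hit_block_nonincreasing => //; lia.
have tb : trivIset setT b.
  move=> i j _ _ [x [[m /= mi hm] [n /= nj hn]]].
  by rewrite -mi -nj (first_hit_inj hm hn).
have : mu (\big[setU/set0]_(i < M.+1) b i) <= 1.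
  by apply: probability_le1; exact: bigsetU_measurable.
apply: le_trans; rewrite measure_bigsetU//.
rewrite (_ : _ * _ = \sum_(i < M.+1) mu (b M)); last first.
  by rewrite sumr_const card_ord mule_natl.
apply: lee_sum => i _; have := le_top (M - i)%N (leq_subr _ _).
by rewrite subKn// -ltnS.
Qed.

Definition has_run (F : set X) (h L : nat) : set X :=
  \bigcup_(s in `I_h) \bigcap_(j in `I_L) (iter (s + j) T @^-1` F).

Lemma measurable_has_run F h L : measurable F -> measurable (has_run F h L).
Proof.
move=> mF; apply: bigcup_measurable => s _.
by apply: bigcap_measurableType => j _; exact: measurable_preimage_iter.
Qed.

(** If the visit to [E] is at least [M.+1] blocks ahead, then the orbit crosses entirely
the next block numbered [M]. *)
Lemma run_of_late_hit E M L n x : (0 < L)%N -> (M.+1 * L <= n)%N ->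
  first_hit E n x -> has_run (hit_block E M.+1 L M) (M.+1 * L).+1 L x.
Proof.
move=> L0 nML hx.
have nE := divn_eq n L; have rL := ltn_pmod n L0; set q := (n %/ L)%N in nE.
have qE := divn_eq q M.+1; have rM := ltn_pmod q (ltn0Sn M).
set r := (n %% L)%N in nE rL; set r' := (q %% M.+1)%N in qE rM.
have Mq : (M < q)%N by rewrite /q leq_divRL.
have c0 : (0 < q %/ M.+1)%N by rewrite divn_gt0.
case: (q %/ M.+1)%N c0 qE => // c _ qE.
(* Block numbers decrease along the orbit: the first complete block congruent to [M]
   is the largest [t] below the current block [q]. *)
pose t := (c * M.+1 + M)%N.
have tL : (n = t * L + (r' * L + L + r))%N by rewrite nE qE /t; nia.
exists (r' * L + r).+1; first by rewrite /= ltnS; nia.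
move=> j; rewrite [X in X -> _]/= => jL; exists (t * L + (L - j.+1))%N.
  rewrite /= divnMDl// divn_small ?addn0 ?ltn_subrL//.
  by rewrite /t modnMDl modn_small.
by apply: first_hit_iter; rewrite [X in first_hit E X](_ : _ = n)//; lia.
Qed.

(** One scale of the construction. The measure of [F] is bounded independently of [L],
and the length [L] of the runs is comparable to the time [M.+1 * L] within which they
start. *)
Lemma exists_long_runs (M L K : nat) : ergodic mu T -> non_atomic mu -> (0 < L)%N ->
  exists F, [/\ measurable F, M.+1%:R%:E * mu F <= 1 &
    K%:R%:E * mu (~` has_run F (M.+1 * L).+1 L) <= 1].
Proof.
move=> erg na L0; have [E [mE E0 smallE]] := non_atomic_small (K * (M.+1 * L)) na.
have mF := measurable_hit_block M.+1 L M mE.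
exists (hit_block E M.+1 L M); split => //; first exact: measure_top_block.
set io := lim_sup_set (fun n => iter n T @^-1` E).
have mio : measurable io.
  apply: bigcap_measurable => // n _; apply: bigcup_measurable => k _.
  exact: measurable_preimage_iter.
set early := \bigcup_(i in `I_(M.+1 * L)) iter i T @^-1` E.
have mearly : measurable early.
  by apply: bigcup_measurable => i _; exact: measurable_preimage_iter.
have sub : ~` has_run (hit_block E M.+1 L M) (M.+1 * L).+1 L `<=` ~` io `|` early.
  move=> x nrun; have [xio|] := pselect (io x); last by left.
  right; have [n _ /= En] := xio 0%N I.
  have [m _ hm] := first_hit_exists En.
  have [mh|mh] := ltnP m (M.+1 * L); first by exists m => //; case: hm.
  by exfalso; apply: nrun; exact: run_of_late_hit hm.
have le1 : mu (~` has_run (hit_block E M.+1 L M) (M.+1 * L).+1 L) <=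
    (M.+1 * L)%:R%:E * mu E.
  apply: (@le_trans _ _ (mu (~` io `|` early))).
    apply: le_measure; rewrite ?inE//.
      by apply: measurableC; exact: measurable_has_run.
    by apply: measurableU => //; exact: measurableC.
  have io0 : mu (~` io) = 0 by rewrite probability_setC// recurrence// subee.
  have mNio : measurable (~` io) by exact: measurableC.
  have : mu (~` io `|` early) <= mu (~` io) + mu early by exact: measureU2.
  rewrite io0 add0e => /le_trans; apply.
  exact: measure_hit_le.
apply: le_trans smallE; rewrite natrM EFinM -muleA.
by rewrite lee_wpmul2l// lee_fin.
Qed.

Lemma borel_cantelli_pow2 (G : (set X)^nat) : (forall k, measurable (G k)) ->
  (forall k, (2 ^ k)%:R%:E * mu (G k) <= 1) -> mu (lim_sup_set G) = 0.
Proof.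
move=> mG leG; apply: lim_sup_set_cvg0 => //.
have bnd k : mu (G k) <= (2 / (2 ^ (k + 1))%:R)%:E.
  have := leG k; rewrite -(fineK (fin_num_measure mu (G k) (mG k))).
  rewrite -EFinM !lee_fin expnD expn1 natrM invfM mulrCA divff// mulr1 => h.
  by rewrite -[leRHS]mul1r ler_pdivlMr ?ltr0n ?expn_gt0// mulrC.
apply: (@le_lt_trans _ _ (\sum_(0 <= k <oo) (2 / (2 ^ (k + 1))%:R)%:E)).
  by apply: lee_nneseries => k _ //; exact: bnd.
have /cvg_lim -> // := @cvg_geometric_eseries_half R 2 0.
by rewrite ltry.
Qed.

End dynamics.

(** * Averages along Omega *)

Lemma limn_esup_eq (R : realType) (u : nat -> R) (l : R) : (forall n, u n <= l) ->
  (forall k n0 : nat, exists2 n, (n0 <= n)%N & l - k.+1%:R^-1 <= u n) ->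
  limn_esup (fun n => (u n)%:E) = l%:E.
Proof.
move=> ul lu; apply/eqP; rewrite eq_le; apply/andP; split.
  apply: (@le_trans _ _ (ereal_sup [set (u n)%:E | n in setT])).
    by apply: ereal_inf_lbound; exists setT => //; exact: filterT.
  by apply: ge_ereal_sup => _ [n _ <-]; rewrite lee_fin.
apply: le_ereal_inf_tmp => _ [V [n0 _ n0V] <-].
apply/lee_addgt0Pr => e e0.
have [k ke] : exists k : nat, k.+1%:R^-1 <= e.
  by have /ltr_add_invr[k] := e0; rewrite add0r => /ltW; exists k.
have [n n0n ln] := lu k n0.
apply: (@le_trans _ _ ((u n)%:E + e%:E)%E).
  by rewrite -EFinD lee_fin -lerBlDr (le_trans _ ln)// lerD2l lerN2.
by rewrite leeD2r//; apply: ereal_sup_ubound; exists n => //; exact: n0V.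
Qed.

Section averages.
Context (R : realType) (X : Type) (T : X -> X).
Implicit Types (A : set X) (x : X).

Lemma Omega_average_ge0 A x N : 0 <= Omega_average R T A x N.
Proof. by rewrite divr_ge0// sumr_ge0. Qed.

Lemma Omega_average_setC A x N : (0 < N)%N ->
  Omega_average R T (~` A) x N = 1 - Omega_average R T A x N.
Proof.
move=> N0; apply/eqP; rewrite eq_sym subr_eq -mulrDl -big_split /=.
rewrite (eq_bigr (fun=> 1)) => [|n _]; last first.
  by rewrite !indicE in_setC; case: (_ \in A); rewrite ?add0r ?addr0.
rewrite sumr_const_nat subSS subn0 divff//.
by rewrite pnatr_eq0 -lt0n.
Qed.

Lemma Omega_average_le1 A x N : Omega_average R T A x N <= 1.
Proof.
case: N => [|N]; first by rewrite /Omega_average invr0 mulr0.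
by rewrite -subr_ge0 -Omega_average_setC// Omega_average_ge0.
Qed.

Lemma Omega_average_ge (good : pred nat) (M : nat) A x N : (0 < N)%N -> (0 < M)%N ->
  (M * \sum_(1 <= n < N.+1) ~~ good n <= N)%N ->
  (forall n, good n -> A (iter (Omega n) T x)) ->
  1 - M%:R^-1 <= Omega_average R T A x N.
Proof.
move=> N0 M0 few goodA.
rewrite lerBlDl -lerBlDr -Omega_average_setC// /Omega_average.
rewrite ler_pdivrMr ?ltr0n// mulrC ler_pdivlMr ?ltr0n// mulrC.
rewrite -(ler_nat R) natrM in few; apply: le_trans few.
rewrite ler_pM2l ?ltr0n// natr_sum; apply: ler_sum => n _.
rewrite indicE ler_nat in_setC.
case: (boolP (good n)) => [/goodA An|_]; last by case: (_ \in _).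
by rewrite mem_set.
Qed.

(** The window is centred at [s + l], at most [M.+2 * (2 * l)]; its half-width [l] is
thus a proportion of the centre that depends on [M] only. *)
Lemma run_average (M : nat) : exists m0, forall (l s : nat) A x,
  (m0 <= l)%N -> (0 < l)%N -> (s <= M.+1 * (2 * l))%N ->
  (forall j, (j < 2 * l)%N -> A (iter (s + j) T x)) ->
  exists2 N, (l <= N)%N & 1 - M.+1%:R^-1 <= Omega_average R T A x N.
Proof.
have [m0 conc] := @Omega_concentration (4 * M.+2) isT; exists m0 => l s A x ml l0 sM run.
have [N [N0 mN few]] := conc (s + l)%N (leq_trans ml (leq_addl _ _)).
exists N; first by apply: leq_trans mN; exact: leq_addl.
apply: (@le_trans _ _ (1 - (4 * M.+2)%:R^-1)).
  by rewrite lerD2l lerN2 lef_pV2 ?posrE ?ltr0n// ler_nat; lia.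
apply: Omega_average_ge few _ => // n /andP[lo hi].
have [sO Os] : (s <= Omega n)%N /\ (Omega n - s < 2 * l)%N by move: lo hi; split; nia.
by rewrite -(subnKC sO); exact: run.
Qed.

End averages.

(** * Superposition of the scales *)

Lemma not_lim_sup_set (X : Type) (F : (set X)^nat) x : ~ lim_sup_set F x ->
  exists n, forall k, (n <= k)%N -> ~ F k x.
Proof.
move=> nF; apply: contrapT => /forallNP H; apply: nF => n _.
apply: contrapT => nn; apply: (H n) => k nk Fk.
by apply: nn; exists k.
Qed.

(** Borel-Cantelli is applied to two sequences of events: the orbit meets [F k] before
time [H k], or it has no run at scale [k]. *)
Lemma Omega_average_oscillates d (X : measurableType d) (R : realType)
    (mu : probability X R) (T : X -> X) :
  measure_preserving mu T -> ergodic mu T -> non_atomic mu ->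
  exists A : set X, measurable A /\
    {ae mu, forall x,
      limn_esup (fun N => (Omega_average R T A x N)%:E) = 1%E /\
      limn_einf (fun N => (Omega_average R T A x N)%:E) = 0%E}.
Proof.
move=> mpT erg na; have [m0 runA] := choice (run_average R T).
pose M k h : nat := (2 ^ k * h)%N.
pose l k h : nat := (m0 (M k h) + k).+1.
(* The windows of scale [k] end before time [H k.+1]; [M k (H k)] makes the measure of
   [F k] at most [2 ^ - k / H k]. The summand [k] in [l] sends the windows to
   infinity. *)
pose H := fix H k := if k is k'.+1 then
  (H k' + (M k' (H k')).+2 * (2 * l k' (H k')) + 1)%N else 1%N.
have HS k : H k.+1 = (H k + (M k (H k)).+2 * (2 * l k (H k)) + 1)%N by [].
have Hle k k' : (k <= k')%N -> (H k <= H k')%N.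
  elim: k' => [|k' IH]; first by rewrite leqn0 => /eqP ->.
  rewrite leq_eqVlt => /predU1P[->//|/IH kk'].
  by rewrite HS; apply: leq_trans kk' _; rewrite -addnA leq_addr.
have H0 k : (0 < H k)%N by apply: (Hle 0%N).
have [F HF] := choice (fun k =>
  @exists_long_runs _ _ _ _ _ mpT (M k (H k)) (2 * l k (H k)) (2 ^ k) erg na isT).
have mF k : measurable (F k) by have [] := HF k.
pose G k := \bigcup_(i in `I_(H k)) iter i T @^-1` F k.
have mG k : measurable (G k).
  by apply: bigcup_measurable => i _; exact: (measurable_preimage_iter mpT).
pose run k := has_run T (F k) ((M k (H k)).+1 * (2 * l k (H k))).+1 (2 * l k (H k)).
pose W k := ~` run k.
have mW k : measurable (W k) by apply: measurableC; exact: (measurable_has_run mpT).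
have G0 : mu (lim_sup_set G) = 0%E.
  apply: borel_cantelli_pow2 => // k; have [_ + _] := HF k.
  apply: le_trans; apply: (@le_trans _ _ ((2 ^ k)%:R%:E * ((H k)%:R%:E * mu (F k)))%E).
    by rewrite lee_wpmul2l ?lee_fin//; exact: measure_hit_le.
  by rewrite muleA -EFinM -natrM lee_wpmul2r// lee_fin ler_nat leqnSn.
have W0 : mu (lim_sup_set W) = 0%E.
  by apply: borel_cantelli_pow2 => // k; have [] := HF k.
pose A := \bigcup_(k in [set k | ~~ odd k])
  (F k `&` \bigcap_(k' in [set k' | (k < k')%N]) ~` F k').
exists A; split.
  apply: bigcup_measurable => k _; apply: measurableI => //.
  by apply: bigcap_measurableType => k' _; exact: measurableC.
have mlim (U : (set X)^nat) : (forall k, measurable (U k)) -> measurable (lim_sup_set U).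
  by move=> mU; apply: bigcap_measurable => // n _; apply: bigcup_measurable.
apply: (@negligibleS _ _ _ _ (lim_sup_set G `|` lim_sup_set W)); last first.
  by apply: negligibleU; apply/negligibleP => //; exact: mlim.
move=> x; apply: contra_notP => /not_orP[nxG nxW].
have [n1 nG] := not_lim_sup_set nxG; have [n2 nW] := not_lim_sup_set nxW.
(* A window of scale [q] lies in [A] or outside [A] according to the parity [b] of
   [q]. *)
have osc (b : bool) (k n0 : nat) : exists2 N, (n0 <= N)%N &
    1 - k.+1%:R^-1 <= Omega_average R T (if b then ~` A else A) x N.
  pose q := (b + (k + n0 + n1 + n2).*2)%N.
  have qb : odd q = b by rewrite oddD odd_double addbF; case: b {q}.
  have [kq n0q n1q n2q] : [/\ k <= q, n0 <= q, n1 <= q & n2 <= q]%N.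
    by rewrite /q -addnn; split; lia.
  clearbody q.
  have [s + runF] : run q x by apply: contrapT; exact: nW.
  rewrite /= ltnS => sM.
  have [|N lN avg] := runA (M q (H q)) (l q (H q)) s (if b then ~` A else A) x
    (leqW (leq_addr _ _)) isT sM.
    move=> j jl; set y := iter (s + j) T x.
    have Fy : F q y by exact: runF.
    have nFy q' : (q < q')%N -> ~ F q' y.
      move=> qq' Fq'; apply: (nG q'); first by rewrite (leq_trans n1q)// ltnW.
      exists (s + j)%N => //=; apply: leq_trans (Hle _ _ qq'); rewrite HS mulSn; lia.
    case: b qb => qb; last by exists q => //=; rewrite qb.
    move=> [q' /= q'b [Fq' nFq']].
    have [qq'|q'q|qq'] := ltngtP q q'; first exact: (nFy q').
      exact: (nFq' q).
    by rewrite -qq' qb in q'b.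
  exists N; first by rewrite (leq_trans _ lN)// leqW// (leq_trans n0q)// leq_addl.
  apply: le_trans avg; rewrite lerD2l lerN2 lef_pV2 ?posrE ?ltr0n// ler_nat ltnS.
  apply: leq_trans kq _; apply: leq_trans (ltnW (ltn_expl q (isT : 1 < 2)%N)) _.
  by rewrite leq_pmulr.
split.
  apply: limn_esup_eq => [N|k n0]; first exact: Omega_average_le1.
  exact: (osc false).
rewrite /limn_einf (@limn_esup_eq _ (fun N => - Omega_average R T A x N) 0).
- by rewrite oppe0.
- by move=> N; rewrite oppr_le0 Omega_average_ge0.
move=> k n0; have [N n0N avg] := osc true k n0.+1.
exists N; first exact: ltnW.
by move: avg; rewrite Omega_average_setC ?(leq_trans _ n0N)// lerD2l sub0r.
Qed.

Theorem theorem1p2 (R : realType) (X : pmetricType R)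
    (mu : probability (borel X) R) (T : borel X -> borel X) :
  compact [set: X] ->
  measure_preserving mu T ->
  ergodic mu T ->
  non_atomic mu ->
  exists A : set (borel X),
    measurable A /\
    {ae mu, forall x,
      limn_esup (fun N => (Omega_average R T A x N)%:E) = 1%E /\
      limn_einf (fun N => (Omega_average R T A x N)%:E) = 0%E}.
Proof. by move=> _; exact: Omega_average_oscillates. Qed.
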